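(* Let $G$ be a 5-dimensional Riemannian Lie group with Lie algebra $\mathfrak g$, carrying a left-invariant, minimal and conformal distribution $\mathcal V$ generated by the Riemannian subalgebra $\mathfrak h^3$, i.e. $\mathcal V=\mathrm{span}\{X,Y,Z\}$ where $\{X,Y,Z,A,B\}$ is an adapted orthonormal basis of $\mathfrak g$ (see context) and $$[Z,X]=X,\quad [Z,Y]=Y,\quad [X,Y]=0.$$ Then the Lie algebra $\mathfrak g$ is one of the following nine; in each of them $[Z,X]=X$, $[Z,Y]=Y$, and the remaining bracket relations are as listed. (1) $[X,A]=-y_3X+y_1Y$, $\ 2y_3[X,B]=-2y_3y_4X+y_1(2y_4-r)Y$, $\ y_1[Y,A]=-y_3^2X+y_1y_3Y$, $\ 2y_1[Y,B]=-y_3(2y_4+r)X+2y_1y_4Y$, $\ [Z,A]=x_5X+y_5Y$, $\ [Z,B]=x_6X+y_6Y$, $\ [A,B]=rA+\theta_1X+\theta_2Y$, where $$-2y_1\theta_1=2rx_5y_1+ry_3y_5+2x_5y_1y_4-2x_6y_1y_3-2y_3^2y_6+2y_3y_4y_5,$$ $$-2y_3\theta_2=rx_5y_1+2ry_3y_5-2x_5y_1y_4+2x_6y_1y_3+2y_3^2y_6-2y_3y_4y_5.$$ (2) $[X,A]=-y_3X+y_1Y$, $\ y_3[X,B]=-y_3y_4X+y_1y_4Y$, $\ [Y,A]=x_3X+y_3Y$, $\ y_3[Y,B]=x_3y_4X+y_3y_4Y$, $\ [Z,A]=x_5X+y_5Y$, $\ [Z,B]=x_6X+y_6Y$, $\ [A,B]=\theta_1X+\theta_2Y$,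 where $$\theta_1y_3=x_3y_4y_5-x_3y_3y_6-x_5y_3y_4+x_6y_3^2,\qquad \theta_2y_3=x_5y_1y_4-x_6y_1y_3+y_3y_4y_5-y_6y_3^2.$$ (3) $[X,B]=-y_4X+y_2Y$, $\ [Y,B]=x_4X+y_4Y$, $\ [Z,A]=x_5X+y_5Y$, $\ [Z,B]=x_6X+y_6Y$, $\ [A,B]=rA-(rx_5-x_4y_5+x_5y_4)X-(ry_5-x_5y_2-y_4y_5)Y$. (4) $2[Z,A]=A+2b_3B+2x_5X+2y_5Y$, $\ 2[Z,B]=-2b_3A+B+2x_6X+2y_6Y$, $\ [A,B]=\theta_1X+\theta_2Y$. (5) $2[X,B]=rX$, $\ [Y,A]=x_3X$, $\ 2[Y,B]=2x_4X-rY$, $\ [Z,A]=x_5X+y_5Y$, $\ [Z,B]=x_6X+y_6Y$, $\ 2[A,B]=2rA+(2x_4y_5-2y_6x_3-rx_5)X-3ry_5Y$. (6) $[X,A]=y_1Y$, $\ 2[X,B]=-rX+2y_2Y$, $\ 2[Y,B]=rY$, $\ [Z,A]=x_5X+y_5Y$, $\ [Z,B]=x_6X+y_6Y$, $\ 2[A,B]=2rA-3rx_5X+(2x_5y_2-2x_6y_1-ry_5)Y$. (7) $x_4[X,A]=x_3y_2Y$, $\ [X,B]=y_2Y$, $\ [Y,A]=x_3X$, $\ [Y,B]=x_4X$, $\ [Z,A]=x_5X+y_5Y$, $\ [Z,B]=x_6X+y_6Y$, $\ [A,B]=(x_4y_5-x_3y_6)X+(x_5y_2-x_6y_1)Y$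 (here $y_1$ is the $Y$-coefficient of $[X,A]$). (8) $[Z,A]=a_3A+b_3B+x_5X+y_5Y$, $\ [Z,B]=-b_3A+a_3B+x_6X+y_6Y$. (9) $2[X,B]=-rX$, $\ 2[Y,B]=-rY$, $\ [Z,A]=-2A+x_5X+y_5Y$, $\ [Z,B]=-2B+x_6X+y_6Y+rZ$, $\ 2[A,B]=2rA-rx_5X-ry_5Y$.
   Context: A Riemannian Lie group is a Lie group $G$ equipped with a left-invariant Riemannian metric $g=\langle\cdot,\cdot\rangle$; this is an inner product on its Lie algebra $\mathfrak g$. A left-invariant distribution $\mathcal V$ is identified with a subspace of $\mathfrak g$; it is integrable iff this subspace is a subalgebra $\mathfrak k$. $\mathcal H=\mathcal V^\perp$ is the orthogonal complement; $\mathcal V,\mathcal H$ also denote the orthogonal projections; $\nabla$ is the Levi-Civita connection. Set $B^{\mathcal V}(U,V)=\frac12\mathcal H(\nabla_UV+\nabla_VU)$ for $U,V\in\mathcal V$ and $B^{\mathcal H}(E,F)=\frac12\mathcal V(\nabla_EF+\nabla_FE)$ for $E,F\in\mathcal H$. The integrable distribution $\mathcal V$ is conformal if there is a vector field $V\in\mathcal V$ with $B^{\mathcal H}=g\otimes V$; minimal if $\mathrm{trace}\,B^{\mathcal V}=0$. Adapted orthonormal basis: $\mathcal V$ is a 3-dimensional integrable, conformal, minimal left-invariant distribution on the 5-dimensional $G$, $\{X,Y,Z,A,B\}$ is an orthonormal basis of $\mathfrak g$ with $\mathcal V=\mathrm{span}\{X,Y,Z\}$ and $\mathcal H=\mathrm{span}\{A,B\}$,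 and $A,B$ are chosen (as is always possible) such that the $\mathcal H$-component of $[A,B]$ is a multiple of $A$. The brackets are then of the form \begin{align*} [X,A]&=a_1A+b_1B+x_1X+y_1Y+z_1Z, & [X,B]&=-b_1A+a_1B+x_2X+y_2Y+z_2Z,\\ [Y,A]&=a_2A+b_2B+x_3X+y_3Y+z_3Z, & [Y,B]&=-b_2A+a_2B+x_4X+y_4Y+z_4Z,\\ [Z,A]&=a_3A+b_3B+x_5X+y_5Y-(x_1+y_3)Z, & [Z,B]&=-b_3A+a_3B+x_6X+y_6Y-(x_2+y_4)Z,\\ [A,B]&=rA+\theta_1X+\theta_2Y+\theta_3Z, \end{align*} with real constants. In the list in the claim, the letters denote these real structure constants, and brackets of basis elements that are not listed (and not determined by antisymmetry) vanish. *)

(* Defs.v *)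
From HB Require Import structures.
From mathcomp Require Import all_boot all_order all_algebra.
From mathcomp Require Import sesquilinear reals.

Set Implicit Arguments.
Unset Strict Implicit.
Unset Printing Implicit Defensive.

Import Order.TTheory GRing.Theory Num.Theory.
Local Open Scope ring_scope.

(* A Riemannian Lie group is represented by its Lie algebra g of left-invariant
   fields: a finite-dimensional real vector space with a Lie bracket br and an
   inner product dot (the left-invariant metric).  Left-invariant distributions
   are subspaces V : {vspace g}.                                              *)

Section LieAlgebra.
Variables (R : realType) (g : vectType R).

Definition lie_bracket (br : {bilinear g -> g -> g}) : Prop :=
  (forall u, br u u = 0) /\
  (forall u v w, br u (br v w) + br v (br w u) + br w (br u v) = 0).

(* Since <u, v> is constant for left-invariant u, v, compatibility of nabla
   with the metric has no derivative term.                                    *)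
Definition levi_civita (br : {bilinear g -> g -> g}) (dot : {dot g for idfun})
    (nabla : {bilinear g -> g -> g}) : Prop :=
  (forall u v, nabla u v - nabla v u = br u v) /\
  (forall u v w, dot (nabla u v) w + dot v (nabla u w) = 0).

Definition integrable (br : {bilinear g -> g -> g}) (V : {vspace g}) : Prop :=
  {in V &, forall u v, br u v \in V}.

Section Distribution.
Variables (dot : {dot g for idfun}) (nabla : {bilinear g -> g -> g}).
Variable V : {vspace g}.

Definition projV : 'End(g) := daddv_pi V (orthov dot V).
Definition projH : 'End(g) := daddv_pi (orthov dot V) V.

Definition BV (u v : g) : g := 2^-1 *: projH (nabla u v + nabla v u).
Definition BH (e f : g) : g := 2^-1 *: projV (nabla e f + nabla f e).

Definition minimal : Prop :=
  forall e : seq g, orthonormal dot e -> <<e>>%VS = V ->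
    \sum_(u <- e) BV u u = 0.

(* BH (e, f) and <e, f> are left-invariant for left-invariant e, f, so the
   field v is itself left-invariant.                                          *)
Definition conformal : Prop :=
  exists2 v, v \in V & {in orthov dot V &, forall e f, BH e f = dot e f *: v}.

End Distribution.

Definition adapted_basis (br : {bilinear g -> g -> g}) (dot : {dot g for idfun})
    (V : {vspace g}) (X Y Z A B : g) : Prop :=
  [/\ orthonormal dot [:: X; Y; Z; A; B],
      V = <<[:: X; Y; Z]>>%VS,
      orthov dot V = <<[:: A; B]>>%VS
    & projH dot V (br A B) \in <[A]>%VS].

End LieAlgebra.

(* The letters of the general bracket table of an adapted basis. *)
Record structure_constants (R : realType) := StructureConstants {
  sc_a1 : R; sc_a2 : R; sc_a3 : R;
  sc_b1 : R; sc_b2 : R; sc_b3 : R;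
  sc_x1 : R; sc_x2 : R; sc_x3 : R; sc_x4 : R; sc_x5 : R; sc_x6 : R;
  sc_y1 : R; sc_y2 : R; sc_y3 : R; sc_y4 : R; sc_y5 : R; sc_y6 : R;
  sc_z1 : R; sc_z2 : R; sc_z3 : R; sc_z4 : R;
  sc_r : R; sc_theta1 : R; sc_theta2 : R; sc_theta3 : R }.

Section BracketTables.
Variables (R : realType) (g : vectType R) (br : {bilinear g -> g -> g}).
Variables (X Y Z A B : g) (c : structure_constants R).

Local Notation a1 := (sc_a1 c). Local Notation b1 := (sc_b1 c).
Local Notation a2 := (sc_a2 c). Local Notation b2 := (sc_b2 c).
Local Notation a3 := (sc_a3 c). Local Notation b3 := (sc_b3 c).
Local Notation x1 := (sc_x1 c). Local Notation y1 := (sc_y1 c).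
Local Notation x2 := (sc_x2 c). Local Notation y2 := (sc_y2 c).
Local Notation x3 := (sc_x3 c). Local Notation y3 := (sc_y3 c).
Local Notation x4 := (sc_x4 c). Local Notation y4 := (sc_y4 c).
Local Notation x5 := (sc_x5 c). Local Notation y5 := (sc_y5 c).
Local Notation x6 := (sc_x6 c). Local Notation y6 := (sc_y6 c).
Local Notation z1 := (sc_z1 c). Local Notation z2 := (sc_z2 c).
Local Notation z3 := (sc_z3 c). Local Notation z4 := (sc_z4 c).
Local Notation r := (sc_r c). Local Notation theta1 := (sc_theta1 c).
Local Notation theta2 := (sc_theta2 c). Local Notation theta3 := (sc_theta3 c).

Definition adapted_brackets : Prop :=
  [/\ br X A = a1 *: A + b1 *: B + x1 *: X + y1 *: Y + z1 *: Z
      /\ br X B = - b1 *: A + a1 *: B + x2 *: X + y2 *: Y + z2 *: Z,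
      br Y A = a2 *: A + b2 *: B + x3 *: X + y3 *: Y + z3 *: Z
      /\ br Y B = - b2 *: A + a2 *: B + x4 *: X + y4 *: Y + z4 *: Z,
      br Z A = a3 *: A + b3 *: B + x5 *: X + y5 *: Y - (x1 + y3) *: Z
      /\ br Z B = - b3 *: A + a3 *: B + x6 *: X + y6 *: Y - (x2 + y4) *: Z
    & br A B = r *: A + theta1 *: X + theta2 *: Y + theta3 *: Z].

Definition h3_brackets : Prop :=
  [/\ br Z X = X, br Z Y = Y & br X Y = 0].

(* When a bracket is given through a multiple of it, as in family1 and family2,
   the multiplier is required to be nonzero, so that the bracket is determined. *)
Definition family1 : Prop :=
  [/\ h3_brackets, y1 != 0 /\ y3 != 0,
      [/\ br X A = - y3 *: X + y1 *: Y,
          (2 * y3) *: br X B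
            = - (2 * y3 * y4) *: X + (y1 * (2 * y4 - r)) *: Y,
          y1 *: br Y A = - y3 ^+ 2 *: X + (y1 * y3) *: Y
        & (2 * y1) *: br Y B
            = - (y3 * (2 * y4 + r)) *: X + (2 * y1 * y4) *: Y],
      [/\ br Z A = x5 *: X + y5 *: Y,
          br Z B = x6 *: X + y6 *: Y
        & br A B = r *: A + theta1 *: X + theta2 *: Y]
    & - (2 * y1 * theta1)
        = 2 * r * x5 * y1 + r * y3 * y5 + 2 * x5 * y1 * y4 - 2 * x6 * y1 * y3
          - 2 * y3 ^+ 2 * y6 + 2 * y3 * y4 * y5
      /\ - (2 * y3 * theta2)
        = r * x5 * y1 + 2 * r * y3 * y5 - 2 * x5 * y1 * y4 + 2 * x6 * y1 * y3
          + 2 * y3 ^+ 2 * y6 - 2 * y3 * y4 * y5].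

Definition family2 : Prop :=
  [/\ h3_brackets, y3 != 0,
      [/\ br X A = - y3 *: X + y1 *: Y,
          y3 *: br X B = - (y3 * y4) *: X + (y1 * y4) *: Y,
          br Y A = x3 *: X + y3 *: Y
        & y3 *: br Y B = (x3 * y4) *: X + (y3 * y4) *: Y],
      [/\ br Z A = x5 *: X + y5 *: Y,
          br Z B = x6 *: X + y6 *: Y
        & br A B = theta1 *: X + theta2 *: Y]
    & theta1 * y3 = x3 * y4 * y5 - x3 * y3 * y6 - x5 * y3 * y4 + x6 * y3 ^+ 2
      /\ theta2 * y3
          = x5 * y1 * y4 - x6 * y1 * y3 + y3 * y4 * y5 - y6 * y3 ^+ 2].

Definition family3 : Prop :=
  [/\ h3_brackets,
      [/\ br X A = 0,
          br X B = - y4 *: X + y2 *: Y,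
          br Y A = 0
        & br Y B = x4 *: X + y4 *: Y]
    & [/\ br Z A = x5 *: X + y5 *: Y,
          br Z B = x6 *: X + y6 *: Y
        & br A B = r *: A - (r * x5 - x4 * y5 + x5 * y4) *: X
                     - (r * y5 - x5 * y2 - y4 * y5) *: Y]].

Definition family4 : Prop :=
  [/\ h3_brackets,
      [/\ br X A = 0, br X B = 0, br Y A = 0 & br Y B = 0]
    & [/\ 2 *: br Z A = A + (2 * b3) *: B + (2 * x5) *: X + (2 * y5) *: Y,
          2 *: br Z B = - (2 * b3) *: A + B + (2 * x6) *: X + (2 * y6) *: Y
        & br A B = theta1 *: X + theta2 *: Y]].

Definition family5 : Prop :=
  [/\ h3_brackets,
      [/\ br X A = 0,
          2 *: br X B = r *: X,
          br Y A = x3 *: X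
        & 2 *: br Y B = (2 * x4) *: X - r *: Y]
    & [/\ br Z A = x5 *: X + y5 *: Y,
          br Z B = x6 *: X + y6 *: Y
        & 2 *: br A B = (2 * r) *: A
            + (2 * x4 * y5 - 2 * y6 * x3 - r * x5) *: X - (3 * r * y5) *: Y]].

Definition family6 : Prop :=
  [/\ h3_brackets,
      [/\ br X A = y1 *: Y,
          2 *: br X B = - r *: X + (2 * y2) *: Y,
          br Y A = 0
        & 2 *: br Y B = r *: Y]
    & [/\ br Z A = x5 *: X + y5 *: Y,
          br Z B = x6 *: X + y6 *: Y
        & 2 *: br A B = (2 * r) *: A - (3 * r * x5) *: X
            + (2 * x5 * y2 - 2 * x6 * y1 - r * y5) *: Y]].

(* The relation x4 [X, A] = x3 y2 Y is the constraint x4 y1 = x3 y2 on the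
   Y-coefficient y1 of [X, A]; x4 = 0 is allowed, and does occur (for instance
   with y2 = 0 and x3, y1 != 0, which belongs to no other family).           *)
Definition family7 : Prop :=
  [/\ h3_brackets,
      br X A = y1 *: Y /\ x4 *: br X A = (x3 * y2) *: Y,
      [/\ br X B = y2 *: Y, br Y A = x3 *: X & br Y B = x4 *: X]
    & [/\ br Z A = x5 *: X + y5 *: Y,
          br Z B = x6 *: X + y6 *: Y
        & br A B = (x4 * y5 - x3 * y6) *: X + (x5 * y2 - x6 * y1) *: Y]].

Definition family8 : Prop :=
  [/\ h3_brackets,
      [/\ br X A = 0, br X B = 0, br Y A = 0 & br Y B = 0]
    & [/\ br Z A = a3 *: A + b3 *: B + x5 *: X + y5 *: Y,
          br Z B = - b3 *: A + a3 *: B + x6 *: X + y6 *: Y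
        & br A B = 0]].

Definition family9 : Prop :=
  [/\ h3_brackets,
      [/\ br X A = 0,
          2 *: br X B = - r *: X,
          br Y A = 0
        & 2 *: br Y B = - r *: Y]
    & [/\ br Z A = - 2 *: A + x5 *: X + y5 *: Y,
          br Z B = - 2 *: B + x6 *: X + y6 *: Y + r *: Z
        & 2 *: br A B = (2 * r) *: A - (r * x5) *: X - (r * y5) *: Y]].

Definition one_of_nine_families : Prop :=
  family1 \/ family2 \/ family3 \/ family4 \/ family5 \/
  family6 \/ family7 \/ family8 \/ family9.

End BracketTables.

(* Main.v *)
Require Import Defs.
From HB Require Import structures.
From mathcomp Require Import all_boot all_order all_algebra.
From mathcomp Require Import sesquilinear reals ring lra.

Set Implicit Arguments.
Unset Strict Implicit.
Unset Printing Implicit Defensive.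

Import Order.TTheory GRing.Theory Num.Theory.
Local Open Scope ring_scope.

(** The classification is a computation with the Jacobi identity once the metric
hypotheses have been turned into linear conditions on structure constants.

Metric part.  For U in V and E, F in H the torsion-free and metric properties
of nabla give <nabla_E F + nabla_F E, U> = <[U, E], F> + <E, [U, F]>, so V is
conformal only if ad U acts on H by conformal matrices (conformal_bracket);
dually, minimality says that ad E has no trace on V (minimal_trace).
In an orthonormal basis these are the symmetries of the general bracket table
(adapted_brackets_exist).

Algebraic part.  The conformal matrices of size two commute, so V acts on
g / V through an abelian Lie algebra; since X = [Z, X] and Y = [Z, Y], the
vectors X and Y act by zero (H_action_trivial).  The abelian ideal <X, Y> of V
is then preserved by A and B (abelian_ideal_normalised).  Write M_A and M_B
for the matrices whose rows are the coordinates of [X, .] and [Y, .] on X, Y,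
and (a3, b3) for the conformal matrix of ad Z on H.  Jacobi now reads

  a3 M_A + b3 M_B + tr(M_A) I = 0 = - b3 M_A + a3 M_B + tr(M_B) I,
  [M_A, M_B] = r M_A - theta3 I,

together with the components of the identity for Z, A, B.  Taking traces in the
first line gives a linear system for (tr M_A, tr M_B) of determinant
(a3 + 2)^2 + b3^2.
- If it vanishes, a3 = -2 and b3 = 0, both matrices are scalar: family 9.
- Otherwise both are traceless.  If (a3, b3) <> 0 they vanish, and the identity
  for Z, A, B leaves families 4 and 8.
- If a3 = b3 = 0 what is left is [M_A, M_B] = r M_A for traceless matrices.
  Either M_A = 0 (family 3), or r = 0 and M_B is proportional to M_A
  (families 2 and 7), or r <> 0, and then M_A is nilpotent because
  r tr(M_A^2) = tr(M_A [M_A, M_B]) = 0 (families 1, 5 and 6). *)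

(** * Inner products, projections and the Levi-Civita connection *)

Section InnerProduct.
Variables (R : realType) (g : vectType R) (dot : {dot g for idfun}).

Lemma dotC (u v : g) : dot u v = dot v u.
Proof. by rewrite hermC expr0 mul1r. Qed.

Lemma dotZl (a : R) (u v : g) : dot (a *: u) v = a * dot u v.
Proof. by rewrite linearZl_LR. Qed.

Lemma dotDl (u v w : g) : dot (u + v) w = dot u w + dot v w.
Proof. exact: linearDl. Qed.

Lemma dotNl (u w : g) : dot (- u) w = - dot u w.
Proof. exact: linearNl. Qed.

Lemma dot0l (w : g) : dot 0 w = 0.
Proof. exact: linear0l. Qed.

(** These rules restate the linearity of dot with dot itself, not its
underlying bilinear map, at the head of the right-hand side, so that they can
be chained by a repeated rewrite. *)
Definition dot_linear := (dotDl, dotNl, dotZl, dot0l).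

Lemma dot_eq0 (u : g) : dot u u = 0 -> u = 0.
Proof.
move=> u0; apply/eqP; apply: contraT => /(neq0_dnorm_gt0 (s := dot)).
by rewrite u0 ltxx.
Qed.

Lemma orthonormal_dot (s : seq g) : orthonormal dot s ->
  forall i j, (i < size s)%N -> (j < size s)%N -> dot s`_i s`_j = (i == j)%:R.
Proof.
elim: s => [|e s IHs] //=; rewrite /orthonormal /= -!andbA.
case/and4P=> /eqP ee ns /allP os ps.
have {}os v : v \in s -> dot e v = 0 by move=> /os /eqP.
have {}IHs : _ := IHs (introT andP (conj ns ps)).
move=> [|i] [|j] //= li lj.
- by rewrite os ?mem_nth.
- by rewrite dotC os ?mem_nth.
exact: IHs.
Qed.

Lemma dot_sum_orthonormal (s : seq g) (a : 'I_(size s) -> R) (i : 'I_(size s)) :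
  orthonormal dot s -> dot (\sum_(j < size s) a j *: s`_j) s`_i = a i.
Proof.
move=> /orthonormal_dot os; rewrite linear_sumlz (bigD1 i) //= big1 => [|j ji].
  by rewrite dotZl os // eqxx mulr1 addr0.
by rewrite dotZl os // (negPf (ji : (j : nat) != i)) mulr0.
Qed.

(** An orthonormal family is free, by dot_sum_orthonormal, so it is a basis when
its length is the dimension; the same lemma reads the coordinates off. *)
Lemma orthonormal_expansion (s : seq g) (u : g) :
  orthonormal dot s -> size s = \dim (fullv : {vspace g}) ->
  u = \sum_(e <- s) dot u e *: e.
Proof.
move=> os sz.
have frs : free (in_tuple s).
  apply/freeP => a a0 i.
  by rewrite -(dot_sum_orthonormal a i os) a0 linear0l.
have us : u \in <<in_tuple s>>%VS.
  suff -> : <<in_tuple s>>%VS = fullv by rewrite memvf.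
  by apply/eqP; rewrite eqEdim subvf -sz (eqP frs) /=.
rewrite {1}(coord_span us) (big_nth 0) big_mkord.
apply: eq_bigr => i _; congr (_ *: _).
by rewrite [in RHS](coord_span us) dot_sum_orthonormal.
Qed.

Lemma capv_orthov (V : {vspace g}) : (V :&: orthov dot V = 0)%VS.
Proof.
apply/eqP; rewrite -subv0; apply/subvP => u.
by rewrite memv_cap memv0 => /andP[uV /mem_orthovP/(_ _ uV)/dot_eq0 ->].
Qed.

Variable V : {vspace g}.
Hypothesis Vfull : (V + orthov dot V)%VS = fullv.

Lemma dot_projV (w u : g) : u \in V -> dot (projV dot V w) u = dot w u.
Proof.
move=> uV; rewrite -[w in RHS](daddv_pi_add (capv_orthov V)) ?Vfull ?memvf //.
rewrite linearDl /= [X in _ + X](_ : _ = 0) ?addr0 //.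
exact: (mem_orthovP (memv_pi _ _ _)).
Qed.

Lemma dot_projH (w u : g) : u \in orthov dot V ->
  dot (projH dot V w) u = dot w u.
Proof.
move=> uV; rewrite -[w in RHS](daddv_pi_add (capv_orthov V)) ?Vfull ?memvf //.
rewrite linearDl /= [X in X + _](_ : _ = 0) ?add0r // dotC.
exact: (mem_orthovP uV _ (memv_pi _ _ _)).
Qed.

Variables (br nabla : {bilinear g -> g -> g}).
Hypothesis hnabla : levi_civita br dot nabla.

Lemma dot_nabla_skew (u v : g) : dot (nabla u v) v = 0.
Proof. by have := hnabla.2 u v v; rewrite [dot v _]dotC => h; lra. Qed.

(** Compatibility gives <nabla_e e, h> = - <e, nabla_e h> = - <e, [e, h]>, as
<e, nabla_h e> = 0: the trace of B^V in the direction h is minus the trace of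
[., h] on V. *)
Lemma minimal_trace (s : seq g) (h : g) : minimal dot nabla V ->
  orthonormal dot s -> <<s>>%VS = V -> h \in orthov dot V ->
  \sum_(e <- s) dot (br e h) e = 0.
Proof.
move=> hmin os sV hH.
have := congr1 (dot^~ h) (hmin s os sV).
rewrite linear0l linear_sumlz => hsum; apply: oppr_inj.
rewrite oppr0 -[RHS]hsum -sumrN; apply: eq_bigr => e _.
rewrite /BV /= dotZl dot_projH // linearDl /= -(hnabla.1 e h) linearBl /=.
have := hnabla.2 e e h; rewrite dot_nabla_skew [dot e _]dotC => hn.
lra.
Qed.

(** Compatibility gives
<nabla_e f + nabla_f e, u> = - <f, nabla_e u> - <e, nabla_f u>.  After
substituting nabla_e u = nabla_u e - [u, e] and its analogue for f, the two
terms in nabla_u cancel, and only brackets with u remain. *)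
Lemma conformal_bracket : conformal dot nabla V ->
  exists v, {in V & orthov dot V, forall u e, forall f, f \in orthov dot V ->
    dot (br u e) f + dot (br u f) e = 2 * dot e f * dot v u}.
Proof.
case=> v _ hv; exists v => u e uV eH f fH.
have := congr1 (dot^~ u) (hv e f eH fH).
rewrite /BH /= !dotZl dot_projV // linearDl /= => hc.
rewrite -(hnabla.1 u e) -(hnabla.1 u f) !linearBl /=.
have eu := mem_orthovP eH u uV; have fu := mem_orthovP fH u uV.
have := hnabla.2 e f u; rewrite [dot f (nabla e u)]dotC.
have := hnabla.2 f e u; rewrite [dot e (nabla f u)]dotC.
have := hnabla.2 u e f; rewrite [dot e (nabla u f)]dotC.
move=> h1 h2 h3; lra.
Qed.

End InnerProduct.

(** * The bracket table of an adapted orthonormal basis *)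

Section AdaptedFrame.
Variables (R : realType) (g : vectType R) (dot : {dot g for idfun}).
Variables (X Y Z A B : g).
Hypothesis orth : orthonormal dot [:: X; Y; Z; A; B].

Lemma frame_dots :
  ((dot X X = 1) * (dot X Y = 0) * (dot X Z = 0) * (dot X A = 0)
   * (dot X B = 0))
  * ((dot Y X = 0) * (dot Y Y = 1) * (dot Y Z = 0) * (dot Y A = 0)
   * (dot Y B = 0))
  * ((dot Z X = 0) * (dot Z Y = 0) * (dot Z Z = 1) * (dot Z A = 0)
   * (dot Z B = 0))
  * ((dot A X = 0) * (dot A Y = 0) * (dot A Z = 0) * (dot A A = 1)
   * (dot A B = 0))
  * ((dot B X = 0) * (dot B Y = 0) * (dot B Z = 0) * (dot B A = 0)
   * (dot B B = 1)).
Proof.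
have o := orthonormal_dot orth.
by do !split; [apply: (o 0 0)|apply: (o 0 1)|apply: (o 0 2)|apply: (o 0 3)
  |apply: (o 0 4)|apply: (o 1 0)|apply: (o 1 1)|apply: (o 1 2)|apply: (o 1 3)
  |apply: (o 1 4)|apply: (o 2 0)|apply: (o 2 1)|apply: (o 2 2)|apply: (o 2 3)
  |apply: (o 2 4)|apply: (o 3 0)|apply: (o 3 1)|apply: (o 3 2)|apply: (o 3 3)
  |apply: (o 3 4)|apply: (o 4 0)|apply: (o 4 1)|apply: (o 4 2)|apply: (o 4 3)
  |apply: (o 4 4)].
Qed.

Hypothesis hdim : \dim (fullv : {vspace g}) = 5%N.

Lemma frame_expansion (u : g) :
  u = dot u A *: A + dot u B *: B + dot u X *: X + dot u Y *: Y + dot u Z *: Z.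
Proof.
rewrite {1}(orthonormal_expansion u orth) ?hdim // !big_cons big_nil addr0.
by rewrite !addrA -[LHS]addrA [LHS]addrC !addrA.
Qed.

Lemma frame_ext (u v : g) :
  [/\ dot u X = dot v X, dot u Y = dot v Y, dot u Z = dot v Z,
      dot u A = dot v A & dot u B = dot v B] -> u = v.
Proof.
by case=> eX eY eZ eA eB; rewrite (frame_expansion u) eX eY eZ eA eB
  -frame_expansion.
Qed.

Variable V : {vspace g}.
Hypotheses (hV : V = <<[:: X; Y; Z]>>%VS) (hH : orthov dot V = <<[:: A; B]>>%VS).

Lemma addv_orthov_frame : (V + orthov dot V)%VS = fullv.
Proof.
apply/eqP; rewrite eqEsubv subvf; apply/subvP => u _.
have inV e : e \in [:: X; Y; Z] -> e \in (V + orthov dot V)%VS.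
  by move=> /memv_span; rewrite -hV; apply: subvP (addvSl _ _) _.
have inH e : e \in [:: A; B] -> e \in (V + orthov dot V)%VS.
  by move=> /memv_span; rewrite -hH; apply: subvP (addvSr _ _) _.
rewrite (frame_expansion u); do ![apply: memvD | apply: memvZ];
  by [rewrite inV // !inE eqxx ?orbT | rewrite inH // !inE eqxx ?orbT].
Qed.

Variables (br nabla : {bilinear g -> g -> g}).
Hypothesis hnabla : levi_civita br dot nabla.

Lemma minimal_frame : minimal dot nabla V -> forall h, h \in [:: A; B] ->
  dot (br X h) X + dot (br Y h) Y + dot (br Z h) Z = 0.
Proof.
move=> hmin h /memv_span; rewrite -hH => hh.
have os : orthonormal dot [:: X; Y; Z].
  by rewrite /orthonormal /ortho_rec /= !frame_dots !eqxx.
have := minimal_trace addv_orthov_frame hnabla hmin os (esym hV) hh.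
by rewrite !big_cons big_nil addr0 addrA.
Qed.

Lemma conformal_frame : conformal dot nabla V -> forall u, u \in [:: X; Y; Z] ->
  dot (br u A) A = dot (br u B) B /\ dot (br u B) A = - dot (br u A) B.
Proof.
move=> hconf u /memv_span; rewrite -hV => uV.
have AH : A \in orthov dot V by rewrite hH memv_span ?inE ?eqxx.
have BH : B \in orthov dot V by rewrite hH memv_span ?inE ?eqxx ?orbT.
have [v hv] := conformal_bracket addv_orthov_frame hnabla hconf.
have := hv u A uV AH A AH; have := hv u B uV BH B BH.
have := hv u A uV AH B BH; rewrite !frame_dots => h1 h2 h3.
by split; lra.
Qed.

(** The structure constants are the coordinates of the brackets; conformality
provides the pattern (a, b), (-b, a) on H, minimality the last Z-coefficients,
and the choice of A the shape of [A, B]. *)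
Lemma adapted_brackets_exist :
    minimal dot nabla V -> conformal dot nabla V ->
    projH dot V (br A B) \in <[A]>%VS ->
  exists c, adapted_brackets br X Y Z A B c.
Proof.
move=> hmin hconf /vlineP[k hk].
have trA : dot (br Z A) Z = - (dot (br X A) X + dot (br Y A) Y).
  by have := minimal_frame hmin (mem_head A _); lra.
have trB : dot (br Z B) Z = - (dot (br X B) X + dot (br Y B) Y).
  by have := minimal_frame hmin (mem_last A [:: B]); rewrite /= => h; lra.
have ABB : dot (br A B) B = 0.
  rewrite -(dot_projH addv_orthov_frame) ?hk ?dotZl ?frame_dots ?mulr0 //.
  by rewrite hH memv_span ?inE ?eqxx ?orbT.
have [XAA XBA] := conformal_frame hconf (mem_head X _).
have [|YAA YBA] := conformal_frame hconf (u := Y); first by rewrite !inE eqxx orbT.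
have [|ZAA ZBA] := conformal_frame hconf (u := Z); first by rewrite !inE eqxx !orbT.
exists (StructureConstants
  (dot (br X A) A) (dot (br Y A) A) (dot (br Z A) A)
  (dot (br X A) B) (dot (br Y A) B) (dot (br Z A) B)
  (dot (br X A) X) (dot (br X B) X) (dot (br Y A) X) (dot (br Y B) X)
  (dot (br Z A) X) (dot (br Z B) X)
  (dot (br X A) Y) (dot (br X B) Y) (dot (br Y A) Y) (dot (br Y B) Y)
  (dot (br Z A) Y) (dot (br Z B) Y)
  (dot (br X A) Z) (dot (br X B) Z) (dot (br Y A) Z) (dot (br Y B) Z)
  (dot (br A B) A) (dot (br A B) X) (dot (br A B) Y) (dot (br A B) Z)).
split; [split|split|split|] => /=.
- exact: frame_expansion.
- by rewrite XAA -XBA -frame_expansion.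
- exact: frame_expansion.
- by rewrite YAA -YBA -frame_expansion.
- by rewrite -scaleNr -trA -frame_expansion.
- by rewrite -scaleNr -trB ZAA -ZBA -frame_expansion.
- by rewrite {1}[br A B]frame_expansion ABB scale0r addr0.
Qed.

End AdaptedFrame.

(** * The Jacobi identity when V is the algebra h3 *)

Section H3Table.
Variables (R : realType) (g : vectType R) (dot : {dot g for idfun}).
Variables (br : {bilinear g -> g -> g}) (X Y Z A B : g).
Variables (a1 a2 a3 b1 b2 b3 x1 x2 x3 x4 x5 x6 y1 y2 y3 y4 y5 y6 : R).
Variables (z1 z2 z3 z4 r theta1 theta2 theta3 : R).
Local Notation c := (StructureConstants a1 a2 a3 b1 b2 b3 x1 x2 x3 x4 x5 x6
  y1 y2 y3 y4 y5 y6 z1 z2 z3 z4 r theta1 theta2 theta3).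
Hypothesis orth : orthonormal dot [:: X; Y; Z; A; B].
Hypothesis hdim : \dim (fullv : {vspace g}) = 5%N.
Hypothesis hbr : lie_bracket br.
Hypothesis hh3 : h3_brackets br X Y Z.
Hypothesis table : adapted_brackets br X Y Z A B c.

Lemma brC (u v : g) : br v u = - br u v.
Proof.
have := hbr.1 (u + v); rewrite linearDl !linearDr /= !hbr.1 add0r addr0 => h.
by apply/eqP; rewrite -addr_eq0 addrC h.
Qed.

(** The form of the Jacobi identity in which each term is a bracket of a basis
vector with a known combination of basis vectors. *)
Lemma br_derivation (u v w : g) :
  br u (br v w) = br (br u v) w + br v (br u w).
Proof.
have := hbr.2 u v w; rewrite (brC (br u v) w) (brC u w) linearNr /=.
by move/eqP; rewrite -addrA -opprD subr_eq0 [br v _ + _]addrC => /eqP.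
Qed.

Lemma bracket_table :
  ((br X X = 0) * (br X Y = 0) * (br Y X = 0) * (br Y Y = 0))
  * ((br Z X = X) * (br X Z = - X) * (br Z Y = Y) * (br Y Z = - Y)
     * (br Z Z = 0))
  * ((br X A = a1 *: A + b1 *: B + x1 *: X + y1 *: Y + z1 *: Z)
   * (br X B = - b1 *: A + a1 *: B + x2 *: X + y2 *: Y + z2 *: Z)
   * (br Y A = a2 *: A + b2 *: B + x3 *: X + y3 *: Y + z3 *: Z)
   * (br Y B = - b2 *: A + a2 *: B + x4 *: X + y4 *: Y + z4 *: Z)
   * (br Z A = a3 *: A + b3 *: B + x5 *: X + y5 *: Y - (x1 + y3) *: Z)
   * (br Z B = - b3 *: A + a3 *: B + x6 *: X + y6 *: Y - (x2 + y4) *: Z))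
  * ((br A X = - br X A) * (br B X = - br X B) * (br A Y = - br Y A)
   * (br B Y = - br Y B) * (br A Z = - br Z A) * (br B Z = - br Z B))
  * ((br A A = 0) * (br B B = 0) * (br B A = - br A B)
   * (br A B = r *: A + theta1 *: X + theta2 *: Y + theta3 *: Z)).
Proof.
have [ZX ZY XY] := hh3.
have [[XA XB] [YA YB] [ZA ZB] AB] := table.
have d := hbr.1.
do !split=> //; try exact: brC.
- by rewrite brC XY oppr0.
- by rewrite brC ZX.
- by rewrite brC ZY.
Qed.

Local Notation br_linear := (linear0l br, linear0r br, linearDl br,
  linearDr br, linearNl br, linearNr br, linearBl br, linearBr br,
  linearZl_LR br, linearZr_LR br).
Local Notation brE := (br_linear, bracket_table).
Local Notation dotE := (dot_linear dot, frame_dots orth).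

(** Modulo V, the right-hand side of [X, A] = [Z, [X, A]] - [X, [Z, A]] is the
commutator of the conformal matrices of ad Z and ad X applied to A, and
conformal matrices of size two commute. *)
Lemma H_action_trivial : [/\ a1 = 0, b1 = 0, a2 = 0 & b2 = 0].
Proof.
have JX := br_derivation Z X A; rewrite !brE /= in JX.
have JY := br_derivation Z Y A; rewrite !brE /= in JY.
have := congr1 (dot^~ A) JX; have := congr1 (dot^~ B) JX.
have := congr1 (dot^~ A) JY; have := congr1 (dot^~ B) JY.
by rewrite !dotE /= => e4 e3 e2 e1; split; lra.
Qed.

(** [X, Y] = 0 forces [X, [Y, A]] = [Y, [X, A]], where now only the Z-components
of [X, A] and [Y, A] contribute, along the independent vectors Y and X. *)
Lemma abelian_ideal_normalised : [/\ z1 = 0, z2 = 0, z3 = 0 & z4 = 0].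
Proof.
have [a10 b10 a20 b20] := H_action_trivial.
have JA := br_derivation X Y A; rewrite !brE /= in JA.
have JB := br_derivation X Y B; rewrite !brE /= in JB.
have := congr1 (dot^~ X) JA; have := congr1 (dot^~ Y) JA.
have := congr1 (dot^~ X) JB; have := congr1 (dot^~ Y) JB.
rewrite !dotE /= a10 b10 a20 b20 => e4 e3 e2 e1; split; lra.
Qed.

Lemma reduced_table :
  ((br X X = 0) * (br X Y = 0) * (br Y X = 0) * (br Y Y = 0))
  * ((br Z X = X) * (br X Z = - X) * (br Z Y = Y) * (br Y Z = - Y)
     * (br Z Z = 0))
  * ((br X A = x1 *: X + y1 *: Y) * (br X B = x2 *: X + y2 *: Y)
   * (br Y A = x3 *: X + y3 *: Y) * (br Y B = x4 *: X + y4 *: Y)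
   * (br Z A = a3 *: A + b3 *: B + x5 *: X + y5 *: Y - (x1 + y3) *: Z)
   * (br Z B = - b3 *: A + a3 *: B + x6 *: X + y6 *: Y - (x2 + y4) *: Z))
  * ((br A X = - br X A) * (br B X = - br X B) * (br A Y = - br Y A)
   * (br B Y = - br Y B) * (br A Z = - br Z A) * (br B Z = - br Z B))
  * ((br A A = 0) * (br B B = 0) * (br B A = - br A B)
   * (br A B = r *: A + theta1 *: X + theta2 *: Y + theta3 *: Z)).
Proof.
have [a10 b10 a20 b20] := H_action_trivial.
have [z10 z20 z30 z40] := abelian_ideal_normalised.
have [XA XB YA YB] : [/\ br X A = x1 *: X + y1 *: Y, br X B = x2 *: X + y2 *: Y,
    br Y A = x3 *: X + y3 *: Y & br Y B = x4 *: X + y4 *: Y].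
  by split; rewrite bracket_table ?a10 ?b10 ?a20 ?b20 ?z10 ?z20 ?z30 ?z40
    ?oppr0 !scale0r !add0r addr0.
by do !split=> //; rewrite bracket_table.
Qed.

Local Notation rE := (br_linear, reduced_table).

(** These are the two matrix equations a3 M_A + b3 M_B + tr(M_A) I = 0 and
- b3 M_A + a3 M_B + tr(M_B) I = 0, entry by entry; the
terms [Z, [X, A]] and [[Z, X], A] of the identity cancel because ad Z is the
identity on <X, Y>. *)
Lemma jacobi_Z_V_H :
  [/\ a3 * x1 + b3 * x2 + (x1 + y3) = 0, a3 * y1 + b3 * y2 = 0,
      a3 * x3 + b3 * x4 = 0 & a3 * y3 + b3 * y4 + (x1 + y3) = 0]
  /\ [/\ - b3 * x1 + a3 * x2 + (x2 + y4) = 0, - b3 * y1 + a3 * y2 = 0,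
      - b3 * x3 + a3 * x4 = 0 & - b3 * y3 + a3 * y4 + (x2 + y4) = 0].
Proof.
have JXA := br_derivation Z X A; rewrite !rE /= in JXA.
have JYA := br_derivation Z Y A; rewrite !rE /= in JYA.
have JXB := br_derivation Z X B; rewrite !rE /= in JXB.
have JYB := br_derivation Z Y B; rewrite !rE /= in JYB.
have := congr1 (dot^~ X) JXA; have := congr1 (dot^~ Y) JXA.
have := congr1 (dot^~ X) JYA; have := congr1 (dot^~ Y) JYA.
have := congr1 (dot^~ X) JXB; have := congr1 (dot^~ Y) JXB.
have := congr1 (dot^~ X) JYB; have := congr1 (dot^~ Y) JYB.
rewrite !dotE /= => e8 e7 e6 e5 e4 e3 e2 e1; split; split; lra.
Qed.

(** This is [M_A, M_B] = r M_A - theta3 I, entry by entry: ad A and ad B act on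
the ideal <X, Y>, and so does their commutator ad [A, B], in which theta3 Z
contributes a multiple of the identity. *)
Lemma jacobi_V_A_B :
  [/\ y1 * x4 - y2 * x3 = r * x1 - theta3,
      x1 * y2 + y1 * y4 - x2 * y1 - y2 * y3 = r * y1,
      x3 * x2 + y3 * x4 - x4 * x1 - y4 * x3 = r * x3
    & x3 * y2 - x4 * y1 = r * y3 - theta3].
Proof.
have JX := br_derivation X A B; rewrite !rE /= in JX.
have JY := br_derivation Y A B; rewrite !rE /= in JY.
have := congr1 (dot^~ X) JX; have := congr1 (dot^~ Y) JX.
have := congr1 (dot^~ X) JY; have := congr1 (dot^~ Y) JY.
rewrite !dotE /= => e4 e3 e2 e1; split; lra.
Qed.

(** The coordinates of [Z, [A, B]] = [[Z, A], B] + [A, [Z, B]] on A, B, Z, X, Y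
in this order; the coefficient 2 a3 is the trace of ad Z on H. *)
Lemma jacobi_Z_A_B :
  [/\ r * a3 + (x1 + y3) * b3 + (x2 + y4) * a3 = 0,
      r * b3 + (x1 + y3) * a3 - (x2 + y4) * b3 = 0,
      r * (x1 + y3) + 2 * a3 * theta3 = 0,
      r * x5 + theta1 = 2 * a3 * theta1 + x5 * x2 + y5 * x4
        - (x1 + y3) * x6 - x6 * x1 - y6 * x3 + (x2 + y4) * x5
    & r * y5 + theta2 = 2 * a3 * theta2 + x5 * y2 + y5 * y4
        - (x1 + y3) * y6 - x6 * y1 - y6 * y3 + (x2 + y4) * y5].
Proof.
have JZ := br_derivation Z A B; rewrite !rE /= in JZ.
have := congr1 (dot^~ X) JZ; have := congr1 (dot^~ Y) JZ.
have := congr1 (dot^~ Z) JZ; have := congr1 (dot^~ A) JZ.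
have := congr1 (dot^~ B) JZ.
rewrite !dotE /= => eB eA eZ eY eX; split; lra.
Qed.

(** * Solving the Jacobi equations *)

Local Notation zeroE := (oppr0, scale0r, addr0, add0r, subr0).

(** The substitution of the coefficients known to vanish only serves to shorten
the five scalar equations to be checked. *)
Ltac by_coordinates zeros := rewrite ?reduced_table ?zeros ?zeroE //;
  apply: (frame_ext orth hdim); rewrite !(dot_linear dot, frame_dots orth) /=;
  split; first [ring | lra].

(** For this ad Z the matrix equations say 2 M_A = tr(M_A) I and
2 M_B = tr(M_B) I; the identity for Z, A, B then fixes the traces. *)
Lemma family9_of_contraction : a3 = - 2 -> b3 = 0 -> family9 br X Y Z A B c.
Proof.
move=> a3E b3E.
have [[XAX XAY YAX YAY] [XBX XBY YBX YBY]] := jacobi_Z_V_H.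
have [e1 e2 e3 e4 e5] := jacobi_Z_A_B.
rewrite a3E b3E in XAX XAY YAX YAY XBX XBY YBX YBY e1 e2 e3 e4 e5.
have x10 : x1 = 0 by lra.
have y30 : y3 = 0 by lra.
have x2E : x2 = - r / 2 by lra.
have y4E : y4 = - r / 2 by lra.
have y10 : y1 = 0 by lra.
have x30 : x3 = 0 by lra.
have y20 : y2 = 0 by lra.
have x40 : x4 = 0 by lra.
rewrite x10 y30 x2E y4E y10 x30 y20 x40 in e3 e4 e5.
have t1 : theta1 = - (r * x5) / 2 by lra.
have t2 : theta2 = - (r * y5) / 2 by lra.
have t3 : theta3 = 0 by lra.
split=> //; split=> /=;
  by_coordinates (a3E, b3E, x10, y10, y20, x30, y30, x40, t3).
Qed.

(** With M_A = M_B = 0 the identity for Z, A, B says that ad Z multiplies [A, B]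
by 2 a3, while ad Z acts as a3 + i b3 on g / V and as 1 on <X, Y>.  So r = 0,
and [A, B] = 0 unless 2 a3 = 1. *)
Lemma family4_or_family8_of_abelian :
    [/\ x1 = 0, y1 = 0, x3 = 0 & y3 = 0] -> [/\ x2 = 0, y2 = 0, x4 = 0 & y4 = 0] ->
    (a3 != 0) || (b3 != 0) ->
  family4 br X Y Z A B c \/ family8 br X Y Z A B c.
Proof.
move=> [x10 y10 x30 y30] [x20 y20 x40 y40] ab.
have [e1 e2 e3 e4 e5] := jacobi_Z_A_B.
have [v1 _ _ _] := jacobi_V_A_B.
rewrite x10 y10 x30 y30 x20 y20 x40 y40 in e1 e2 e3 e4 e5 v1.
have t3 : theta3 = 0 by lra.
have r0 : r = 0.
  case/orP: ab => h; apply: (mulIf h); lra.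
rewrite r0 in e4 e5.
have f1 : (2 * a3 - 1) * theta1 = 0 by lra.
have f2 : (2 * a3 - 1) * theta2 = 0 by lra.
have [a3E|a3N] := eqVneq (2 * a3 - 1) 0.
  left; split=> //; split=> /=;
    by_coordinates (x10, y10, x20, y20, x30, y30, x40, y40, r0, t3).
have t1 : theta1 = 0 by apply: (mulfI a3N); lra.
have t2 : theta2 = 0 by apply: (mulfI a3N); lra.
right; split=> //; split=> /=;
  by_coordinates (x10, y10, x20, y20, x30, y30, x40, y40, r0, t1, t2, t3).
Qed.

(** In this section ad Z vanishes on H modulo V and M_A, M_B are traceless. *)
Section Tangential.
Hypotheses (a30 : a3 = 0) (b30 : b3 = 0) (x1E : x1 = - y3) (x2E : x2 = - y4).

Lemma theta3_eq0 : theta3 = 0.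
Proof.
have [e1 _ _ e4] := jacobi_V_A_B; rewrite x1E in e1.
lra.
Qed.

Lemma tangential_commutator :
  [/\ y1 * x4 - y2 * x3 = - r * y3, 2 * (y1 * y4 - y2 * y3) = r * y1
    & 2 * (y3 * x4 - x3 * y4) = r * x3].
Proof.
have [e1 e2 e3 e4] := jacobi_V_A_B; have t3 := theta3_eq0.
by rewrite x1E x2E t3 in e1 e2 e3 e4; split; lra.
Qed.

Lemma tangential_theta :
  theta1 = - r * x5 - x5 * y4 + y5 * x4 + x6 * y3 - y6 * x3 /\
  theta2 = - r * y5 + x5 * y2 + y5 * y4 - x6 * y1 - y6 * y3.
Proof.
have [_ _ _ e4 e5] := jacobi_Z_A_B.
by rewrite x1E x2E a30 in e4 e5; split; lra.
Qed.

(** r tr(M_A^2) = tr(M_A [M_A, M_B]) = 0, and tr(M_A^2) = 2 (y3^2 + x3 y1). *)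
Lemma tangential_nilpotent : r != 0 -> y3 ^+ 2 + x3 * y1 = 0.
Proof.
move=> rN; have [e1 e2 e3] := tangential_commutator.
apply: (mulfI rN); rewrite mulr0.
have f1 := congr1 ( *%R y3) e1; have f2 := congr1 ( *%R x3) e2.
have f3 := congr1 ( *%R y1) e3.
lra.
Qed.

Lemma tangential_table :
  ((br X A = - y3 *: X + y1 *: Y) * (br X B = - y4 *: X + y2 *: Y)
   * (br Y A = x3 *: X + y3 *: Y) * (br Y B = x4 *: X + y4 *: Y))
  * ((br Z A = x5 *: X + y5 *: Y) * (br Z B = x6 *: X + y6 *: Y)
   * (br A B = r *: A + theta1 *: X + theta2 *: Y)).
Proof.
do !split; rewrite reduced_table ?x1E ?x2E ?theta3_eq0 ?a30 ?b30;
  by rewrite ?oppr0 ?addNr ?(scale0r, add0r, subr0, addr0).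
Qed.

Ltac by_tangential_coordinates := rewrite ?tangential_table //;
  apply: (frame_ext orth hdim); rewrite !(dot_linear dot, frame_dots orth) /=;
  split; first [ring | lra].

Lemma family3_of_A_central : y1 = 0 -> x3 = 0 -> y3 = 0 ->
  family3 br X Y Z A B c.
Proof.
move=> y10 x30 y30; have [t1 t2] := tangential_theta.
rewrite y10 x30 y30 in t1 t2.
by split=> //; split=> /=; by_tangential_coordinates.
Qed.

(** M_B commutes with M_A <> 0, so M_B = (y4 / y3) M_A. *)
Lemma family2_of_commuting : r = 0 -> y3 != 0 -> family2 br X Y Z A B c.
Proof.
move=> r0 y3N; have [t1 t2] := tangential_theta.
have [e1 e2 e3] := tangential_commutator; rewrite r0 in t1 t2 e1 e2 e3.
have f1 := congr1 ( *%R y3) t1; have f2 := congr1 ( *%R y3) t2.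
have g2 := congr1 ( *%R x5) e2; have g3 := congr1 ( *%R y5) e3.
split=> //=; [split|split|split; lra]; by_tangential_coordinates.
Qed.

(** M_A <> 0 is off-diagonal, hence so is M_B, which commutes with it. *)
Lemma family7_of_commuting : r = 0 -> y3 = 0 -> (y1 != 0) || (x3 != 0) ->
  family7 br X Y Z A B c.
Proof.
move=> r0 y30 n; have [t1 t2] := tangential_theta.
have [e1 e2 e3] := tangential_commutator.
rewrite r0 y30 in t1 t2 e1 e2 e3.
have y40 : y4 = 0 by case/orP: n => h; apply: (mulfI h); lra.
rewrite y40 in t1 t2.
by split=> //; split=> /=; rewrite ?tangential_table ?y30 ?y40;
  by_tangential_coordinates.
Qed.

Lemma family1_of_nilpotent : r != 0 -> y3 != 0 -> family1 br X Y Z A B c.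
Proof.
move=> rN y3N; have nil := tangential_nilpotent rN.
have [t1 t2] := tangential_theta.
have [e1 e2 e3] := tangential_commutator.
have y1N : y1 != 0.
  apply: contra_neqN y3N => /eqP y10; apply/eqP; rewrite -sqrf_eq0.
  by rewrite y10 mulr0 addr0 in nil; apply/eqP.
(* The entry of [M_A, M_B] = r M_A below the diagonal, multiplied by y1 so that
   x3 y1 can be replaced by - y3^2, is divisible by y3. *)
have YBX : 2 * (y1 * x4) = - (y3 * (2 * y4 + r)).
  apply: (mulfI y3N); have := congr1 ( *%R y1) e3.
  have := congr1 ( *%R y4) nil; have := congr1 ( *%R r) nil; move=> h1 h2 h3.
  lra.
have f1 := congr1 ( *%R y1) t1; have f2 := congr1 ( *%R y3) t2.
have g1 := congr1 ( *%R y5) YBX; have g2 := congr1 ( *%R y6) nil.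
have g3 := congr1 ( *%R x5) e2.
split=> //=; [split|split|split; lra]; by_tangential_coordinates.
Qed.

(** A nilpotent M_A with zero diagonal is strictly triangular; M_B is then
triangular with diagonal entries fixed by [M_A, M_B] = r M_A. *)
Lemma family5_or_family6_of_nilpotent : r != 0 -> y3 = 0 ->
    (y1 != 0) || (x3 != 0) ->
  family5 br X Y Z A B c \/ family6 br X Y Z A B c.
Proof.
move=> rN y30 n; have nil := tangential_nilpotent rN.
have [t1 t2] := tangential_theta.
have [e1 e2 e3] := tangential_commutator.
rewrite y30 in t1 t2 e1 e2 e3 nil.
have [y10|y1N] := eqVneq y1 0.
  rewrite y10 eqxx /= in n; rewrite y10 in t1 t2 e1 e2.
  have y4E : y4 = - r / 2 by apply: (mulfI n); lra.
  have y20 : y2 = 0 by apply: (mulfI n); lra.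
  rewrite y4E y20 in t1 t2.
  by left; split=> //; split=> /=; by_tangential_coordinates.
have x30 : x3 = 0 by apply: (mulfI y1N); lra.
rewrite x30 in t1 t2 e1 e3.
have y4E : y4 = r / 2 by apply: (mulfI y1N); lra.
have x40 : x4 = 0 by apply: (mulfI y1N); lra.
rewrite y4E x40 in t1 t2.
by right; split=> //; split=> /=; by_tangential_coordinates.
Qed.

End Tangential.

Lemma h3_classification : one_of_nine_families br X Y Z A B c.
Proof.
have [[XAX XAY YAX YAY] [XBX XBY YBX YBY]] := jacobi_Z_V_H.
rewrite /one_of_nine_families.
have [/andP[/eqP a3E /eqP b3E]|n] := boolP ((a3 == - 2) && (b3 == 0)).
  by have := family9_of_contraction a3E b3E; tauto.
(* The determinant of the linear system trA, trB for the two traces. *)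
have dN : (a3 + 2) ^+ 2 + b3 ^+ 2 != 0.
  by rewrite paddr_eq0 ?sqr_ge0 // !sqrf_eq0 addr_eq0.
have trA : (a3 + 2) * (x1 + y3) + b3 * (x2 + y4) = 0 by lra.
have trB : - b3 * (x1 + y3) + (a3 + 2) * (x2 + y4) = 0 by lra.
have x1E : x1 = - y3.
  apply/eqP; rewrite -addr_eq0; apply/eqP/(mulfI dN).
  have := congr1 ( *%R (a3 + 2)) trA; have := congr1 ( *%R b3) trB => h1 h2.
  lra.
have x2E : x2 = - y4.
  apply/eqP; rewrite -addr_eq0; apply/eqP/(mulfI dN).
  have := congr1 ( *%R b3) trA; have := congr1 ( *%R (a3 + 2)) trB => h1 h2.
  lra.
have [ab0|abN] := eqVneq (a3 ^+ 2 + b3 ^+ 2) 0; last first.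
  have ab : (a3 != 0) || (b3 != 0).
    by move: abN; rewrite paddr_eq0 ?sqr_ge0 // !sqrf_eq0 negb_and.
  rewrite x1E x2E in XAX YAY XBX YBY.
  (* The matrix (a3, b3; - b3, a3) is invertible, and each entry of (M_A, M_B)
     lies in its kernel. *)
  have kill u w : a3 * u + b3 * w = 0 -> - b3 * u + a3 * w = 0 ->
      u = 0 /\ w = 0.
    move=> h1 h2; have := congr1 ( *%R a3) h1; have := congr1 ( *%R b3) h1.
    have := congr1 ( *%R a3) h2; have := congr1 ( *%R b3) h2.
    by move=> k1 k2 k3 k4; split; apply: (mulfI abN); lra.
  have [y30 y40] : y3 = 0 /\ y4 = 0 by apply: kill; lra.
  have [y10 y20] := kill _ _ XAY XBY; have [x30 x40] := kill _ _ YAX YBX.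
  rewrite y30 oppr0 in x1E; rewrite y40 oppr0 in x2E.
  have MA0 : [/\ x1 = 0, y1 = 0, x3 = 0 & y3 = 0] by [].
  have MB0 : [/\ x2 = 0, y2 = 0, x4 = 0 & y4 = 0] by [].
  by have := family4_or_family8_of_abelian MA0 MB0 ab; tauto.
have [/eqP a30 /eqP b30] : a3 == 0 /\ b3 == 0.
  by apply/andP; move: ab0 => /eqP; rewrite paddr_eq0 ?sqr_ge0 // !sqrf_eq0.
have [y30|y3N] := eqVneq y3 0; last first.
  have [r0|rN] := eqVneq r 0.
    by have := family2_of_commuting a30 b30 x1E x2E r0 y3N; tauto.
  by have := family1_of_nilpotent a30 b30 x1E x2E rN y3N; tauto.
have [n0|nz] := boolP ((y1 == 0) && (x3 == 0)).
  case/andP: n0 => /eqP y10 /eqP x30.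
  by have := family3_of_A_central a30 b30 x1E x2E y10 x30 y30; tauto.
rewrite negb_and in nz.
have [r0|rN] := eqVneq r 0.
  by have := family7_of_commuting a30 b30 x1E x2E r0 y30 nz; tauto.
by have := family5_or_family6_of_nilpotent a30 b30 x1E x2E rN y30 nz; tauto.
Qed.

End H3Table.

Theorem theorem9p1 (R : realType) (g : vectType R)
    (br : {bilinear g -> g -> g}) (dot : {dot g for idfun})
    (nabla : {bilinear g -> g -> g}) (V : {vspace g}) (X Y Z A B : g)
    (hdim : \dim (fullv : {vspace g}) = 5%N)
    (hbr : lie_bracket br)
    (hnabla : levi_civita br dot nabla)
    (hint : integrable br V)
    (hmin : minimal dot nabla V)
    (hconf : conformal dot nabla V)
    (hbasis : adapted_basis br dot V X Y Z A B)
    (hh3 : h3_brackets br X Y Z) :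
  exists c : structure_constants R,
    adapted_brackets br X Y Z A B c /\ one_of_nine_families br X Y Z A B c.
Proof.
have [orth hV hH hAB] := hbasis.
have [c table] := adapted_brackets_exist orth hdim hV hH hnabla hmin hconf hAB.
exists c; split=> //; case: c table => *.
exact: (h3_classification orth).
Qed.
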